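(* The map $I\mapsto I^*$ is a bijection from the set of all $\mathbb N$-ideals of $P$ onto the set of all saturated multigraded $\mathbb N$-ideals of $\bar P$.
   Context: $K$ is a field, $X=\{x_1,x_2,\ldots\}$ a finite or countable set, $t$ a new variable, $\bar X=X\cup\{t\}$, $\mathbb N=\{0,1,\ldots\}$, $\mathbb N^*=\mathbb N\setminus\{0\}$. $P=K[X\times\mathbb N^*]\subset\bar P=K[\bar X\times\mathbb N^*]$ are the commutative polynomial algebras in the variables $x_i(j)$, respectively $x_i(j)$ and $t(j)$ ($i,j\ge1$). $\mathbb N$ acts by algebra endomorphisms $k\cdot x_i(j)=x_i(k+j)$, $k\cdot t(j)=t(k+j)$. An ideal $I$ is an $\mathbb N$-ideal if $k\cdot f\in I$ for all $f\in I$, $k\in\mathbb N$. The multidegree of a monomial is $\mu=(\mu_k)_{k\ge1}$, where $\mu_k$ is the number of its variables (with multiplicity) with place index $k$; ''multigraded'' and ''multihomogeneous'' refer to the corresponding grading. $\psi:\bar P\to\bar P$ is the algebra endomorphism $x_i(j)\mapsto x_i(j)$, $t(j)\mapsto1$, with image $P$. For an $\mathbb N$-ideal $I\subset P$, the multihomogenization $I^*\subset\bar P$ is the largest multigraded $\mathbb N$-ideal contained in $\psi^{-1}(I)$, i.e. the ideal generated by all multihomogeneous elements of $\psi^{-1}(I)$. For a multigraded $\mathbb N$-ideal $J\subset\bar P$, $\mathrm{Sat}(J)=\psi(J)^*$, and $J$ is saturated if $J=\mathrm{Sat}(J)$. *)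

(* Defs.v *)
From mathcomp Require Import all_boot all_algebra finmap monalg.
From mathcomp Require Import boolp classical_sets functions.

Set Implicit Arguments.
Unset Strict Implicit.
Unset Printing Implicit Defensive.

Import GRing.Theory.
Local Open Scope ring_scope.
Local Open Scope classical_set_scope.

(* The place indices 1, 2, 3, ... *)
Notation place := {j : nat | (0 < j)%N}.

Lemma shift_place_gt0 (k : nat) (j : place) : (0 < k + val j)%N.
Proof. by rewrite addn_gt0 (valP j) orbT. Qed.

Definition shift_place (k : nat) (j : place) : place :=
  exist _ (k + val j)%N (shift_place_gt0 k j).

(* K[V x N^*]: commutative polynomials in the variables v(j), as the monoid   *)
(* algebra of the free commutative monoid on V * place, which allows          *)
(* infinitely many variables.                                                 *)
Notation placed_poly K V := {malg K[{cmonom (V * place)%type}]}.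

Section PlacedPoly.
Context (K : fieldType) (V : choiceType).
Implicit Types (f : placed_poly K V) (m : {cmonom (V * place)%type}).

Definition var (v : V) (j : place) : placed_poly K V := << ucm (v, j) >>.

(* The K-algebra morphism sending v(j) to h v j. *)
Definition subst (W : choiceType) (h : V -> place -> placed_poly K W) f :
    placed_poly K W :=
  mmap (@mkmalgU _ K (@mone {cmonom (W * place)%type}))
    (fun m => \prod_(p <- finsupp (cmonom_val m)) h p.1 p.2 ^+ m p) f.

Definition shift (k : nat) : placed_poly K V -> placed_poly K V :=
  subst (fun v j => var v (shift_place k j)).

(* The multidegree, a finitely supported function place -> nat, is encoded in *)
(* the type {cmonom place}; see multidegE for its values.                     *)
Definition multideg m : {cmonom place} :=
  [cmonom (\sum_(p <- finsupp (cmonom_val m) | p.2 == k) m p)%N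
    | k in [fset p.2 | p in finsupp (cmonom_val m)]%fset]%M.

Lemma multidegE m k :
  multideg m k = (\sum_(p <- finsupp (cmonom_val m) | p.2 == k) m p)%N.
Proof.
rewrite /multideg cmE fsfunE.
case: ifPn => // /imfsetP km.
rewrite big_seq_cond big1 // => p /andP[pm /eqP pk].
by case: km; exists p.
Qed.

Definition multihomogeneous f : Prop :=
  exists mu, forall m, m \in msupp f -> multideg m = mu.

Definition mhcomponent (mu : {cmonom place}) f : placed_poly K V :=
  \sum_(m <- msupp f | multideg m == mu) << f@_m *g m >>.

Definition is_ideal (I : set (placed_poly K V)) : Prop :=
  [/\ I 0, (forall f g, I f -> I g -> I (f + g))
    & forall f g, I g -> I (f * g)].

Definition N_ideal (I : set (placed_poly K V)) : Prop :=
  is_ideal I /\ forall k f, I f -> I (shift k f).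

Definition multigraded (J : set (placed_poly K V)) : Prop :=
  forall mu f, J f -> J (mhcomponent mu f).

End PlacedPoly.

Section Multihomogenization.
Context (K : fieldType) (X : choiceType).

(* X u {t} is option X, with None in the role of t.  P and its extension are  *)
(* distinct types, so psi is corestricted to its image P.                     *)
Definition psi : placed_poly K (option X) -> placed_poly K X :=
  subst (fun v j => if v is Some x then var K x j else 1).

Definition multihomogenization (I : set (placed_poly K X)) :
    set (placed_poly K (option X)) :=
  smallest (@is_ideal K (option X))
    [set f | multihomogeneous f /\ I (psi f)].

Definition Sat (J : set (placed_poly K (option X))) :
    set (placed_poly K (option X)) :=
  multihomogenization (psi @` J).

Definition saturated (J : set (placed_poly K (option X))) : Prop := J = Sat J.

End Multihomogenization.

(* Main.v *)
Require Import Defs.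
From mathcomp Require Import all_boot all_algebra finmap monalg.
From mathcomp Require Import boolp classical_sets functions.

(** Write I^* for the multihomogenization of I.  Everything follows from the
    identity psi(I^* ) = I, valid for every ideal I of P
    ([psi_multihomogenization]).  It makes I |-> I^* injective, it gives
    Sat(I^* ) = psi(I^* )^* = I^*, and a saturated J is by definition the image
    psi(J)^* of psi(J), which is an N-ideal when J is one.

    The inclusion of psi(I^* ) in I holds because psi^-1(I) is an ideal
    containing the generators of I^*.  For the converse, each f in P is the
    image of a multihomogeneous polynomial ([psi_homog_surj]): psi sends each
    t(j) to 1, so the summands of f can be padded with variables t(j) up to a
    common multidegree.

    It remains to see that I^* is a multigraded N-ideal.  Both facts are
    checked on generators, since the elements whose shifts, resp. whose
    multihomogeneous components, all lie in I^* form an ideal.  For shifts,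
    k.f is multihomogeneous when f is ([homog_shift]) and psi commutes with the
    shifts ([psi_shift]).  For components, multiplying by a monomial merely
    translates the multidegrees ([mhcomponentUM]). *)

Local Open Scope classical_set_scope.

(** * Monomials and their multidegree *)

Section Monomials.
Context {I : choiceType}.

Lemma cmonom_ind (P : {cmonom I} -> Prop) :
  P mone -> (forall i m, P m -> P (mmul (ucm i) m)) -> forall m, P m.
Proof.
move=> P1 PM m; elim: {m}(mdeg m) {-2}m (erefl (mdeg m)) => [|n IHn] m.
  by move/eqP; rewrite mdeg_eq0 => /eqP ->.
move=> mE; have: m != mone by rewrite -mdeg_eq0 mE.
case: (fset_0Vmem (finsupp (cmonom_val m))) => [m0|[i im] _].
  by case/negP; rewrite -mdeg_eq0 mdegE m0 big_seq_fset0.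
have mi : (0 < m i)%N by rewrite lt0n cmE_neq0.
have defm : m = mmul (ucm i) (divcm m (ucm i)).
  apply/eqP/cmP => j; rewrite cmM divcmE ucmE.
  by case: eqP => [<-|_]; rewrite ?subn0 ?subnKC.
rewrite defm; apply/PM/IHn/eqP.
by move/eqP: mE; rewrite {1}defm mdegM mdegU.
Qed.

Lemma mmulI (m : {cmonom I}) : injective (mmul m : {cmonom I} -> {cmonom I}).
Proof.
move=> m1 m2 e; apply/eqP/cmP => i; apply: (@addnI (m i)).
by rewrite -!cmM e.
Qed.

Context {T : Type} {idx : T} (op : Monoid.com_law idx).

(** The extension of [g] to a morphism from the free commutative monoid on [I]
    to an arbitrary commutative monoid.  Taking [T] to be [nat], another free
    commutative monoid, or the multiplicative monoid of a ring yields
    respectively the entries of the multidegree, the action of the shift on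
    multidegrees, and the value of [subst] on monomials, since [x ^+ n] is
    [iterop n *%R x 1]. *)
Definition cmfold (g : I -> T) (m : {cmonom I}) : T :=
  \big[op/idx]_(i <- finsupp (cmonom_val m)) iterop (m i) op (g i) idx.

Lemma cmfoldEw g (m : {cmonom I}) (d : {fset I}) :
  (finsupp (cmonom_val m) `<=` d)%fset ->
  cmfold g m = \big[op/idx]_(i <- d) iterop (m i) op (g i) idx.
Proof.
move=> le; apply: big_fset_incl => // i _.
by rewrite -cmE_eq0 => /eqP ->.
Qed.

Lemma cmfold1 g : cmfold g mone = idx.
Proof. by rewrite /cmfold mdom1 big_seq_fset0. Qed.

Lemma cmfoldU g i : cmfold g (ucm i) = g i.
Proof. by rewrite /cmfold mdomU big_seq_fset1 cmUU. Qed.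

Lemma cmfoldM g m1 m2 :
  cmfold g (mmul m1 m2) = op (cmfold g m1) (cmfold g m2).
Proof.
rewrite (cmfoldEw g m1 _ (fsubsetUl _ (finsupp (cmonom_val m2)))).
rewrite (cmfoldEw g m2 _ (fsubsetUr (finsupp (cmonom_val m1)) _)).
rewrite {1}/cmfold mdomD -big_split /=; apply: eq_bigr => i _.
rewrite cmM !Monoid.iteropE iterD; elim: (m1 i) => [|n /= ->] /=.
  by rewrite Monoid.mul1m.
by rewrite Monoid.mulmA.
Qed.
End Monomials.

Section Multidegree.
Context {V : choiceType}.
Implicit Types m : {cmonom (V * place)%type}.

Lemma multideg_fold m k :
  multideg m k = cmfold addn (fun p : V * place => (p.2 == k) : nat) m.
Proof.
rewrite multidegE big_mkcond; apply: eq_bigr => p _; rewrite Monoid.iteropE.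
rewrite iter_addn_0.
by case: (p.2 == k); rewrite ?mul1n ?mul0n.
Qed.

Lemma multideg1 : multideg (mone : {cmonom (V * place)%type}) = mone.
Proof. by apply/eqP/cmP => k; rewrite multideg_fold cmfold1 cm1. Qed.

Lemma multidegU v j : multideg (ucm (v, j) : {cmonom (V * place)%type}) = ucm j.
Proof. by apply/eqP/cmP => k; rewrite multideg_fold cmfoldU cmU. Qed.

Lemma multidegM m1 m2 :
  multideg (mmul m1 m2) = mmul (multideg m1) (multideg m2).
Proof. by apply/eqP/cmP => k; rewrite cmM !multideg_fold cmfoldM. Qed.

End Multidegree.

(** * Multihomogeneous polynomials and components *)

Section Homogeneity.
Import GRing.Theory.
Local Open Scope ring_scope.
Context {K : fieldType} {V : choiceType}.
Local Notation M := {cmonom (V * place)%type}.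
Implicit Types (f g : placed_poly K V) (mu nu : {cmonom place}) (m : M).

Lemma placed_poly_monom_ind (P : placed_poly K V -> Prop) :
    P 0 -> (forall f g, P f -> P g -> P (f + g)) ->
  (forall c m, P << c *g m >>) -> forall f, P f.
Proof.
move=> P0 PD PU f; rewrite (monalgE f).
elim: (enum_fset _) => [|m s IHs]; first by rewrite big_nil.
by rewrite big_cons; apply: PD.
Qed.

Lemma malgU_var c v j m :
  << c *g mmul (ucm (v, j)) m >> = var K v j * << c *g m >>.
Proof. by rewrite -[c in LHS]mul1r -fgmulUU -malgM_def. Qed.

Lemma placed_poly_ind (P : placed_poly K V -> Prop) :
    (forall c, P c%:MP) -> (forall f g, P f -> P g -> P (f + g)) ->
  (forall v j f, P f -> P (var K v j * f)) -> forall f, P f.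
Proof.
move=> PC PD PV; apply: placed_poly_monom_ind => //.
  by rewrite -malgC0E; apply: PC.
move=> c; apply: cmonom_ind => [|[v j] m Pm]; first exact: PC.
by rewrite malgU_var; apply: PV.
Qed.

(** [multihomogeneous] with the multidegree exposed; as the zero polynomial is
    homogeneous of every multidegree, the latter is not a function of [f]. *)
Definition homog mu f := forall m, m \in msupp f -> multideg m = mu.

Lemma homogU c m : homog (multideg m) << c *g m >>.
Proof. by move=> n /(fsubsetP msuppU_le); rewrite in_fset1 => /eqP ->. Qed.

Lemma homogC c : homog mone c%:MP.
Proof. by rewrite -(@multideg1 V); apply: homogU. Qed.

Lemma homog_var v j : homog (ucm j) (var K v j).
Proof. by rewrite -(multidegU v); apply: homogU. Qed.

Lemma homog0 mu : homog mu 0.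
Proof. by move=> m; rewrite msupp0 in_fset0. Qed.

Lemma homogD mu f g : homog mu f -> homog mu g -> homog mu (f + g).
Proof.
move=> hf hg m /(fsubsetP (msuppD_le _ _)); rewrite in_fsetU.
by case/orP => [/hf|/hg].
Qed.

Lemma homogM mu nu f g :
  homog mu f -> homog nu g -> homog (mmul mu nu) (f * g).
Proof.
move=> hf hg m /msuppM_le [m1 [m2 [m1f m2g ->]]].
by rewrite multidegM (hf _ m1f) (hg _ m2g).
Qed.

Lemma mhcomponentE mu f m :
  (mhcomponent mu f)@_m = if multideg m == mu then f@_m else 0.
Proof.
rewrite /mhcomponent raddf_sum /=.
have [mf|mf] := boolP (m \in msupp f); last first.
  rewrite (mcoeff_outdom mf) if_same big_seq_cond big1 // => n /andP[nf _].
  by rewrite mcoeffU; case: eqP nf mf => [->->|].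
rewrite big_mkcond (big_fsetD1 m mf) /= big_seq big1 ?addr0.
  by case: ifP => // _; apply: mcoeffUU.
move=> n; rewrite in_fsetD1 => /andP[/negPf nm _].
by case: ifP => // _; rewrite mcoeffU nm.
Qed.

Lemma mhcomponentD mu f g :
  mhcomponent mu (f + g) = mhcomponent mu f + mhcomponent mu g.
Proof.
apply/malgP => m.
rewrite (mhcomponentE mu (f + g)).
rewrite [RHS]mcoeffD [X in _ = X + _]mhcomponentE.
rewrite [X in _ = _ + X]mhcomponentE.
rewrite (mcoeffD m f g).
by case: ifP; rewrite ?addr0.
Qed.

Lemma mhcomponent_homog mu nu f : homog nu f ->
  mhcomponent mu f = if nu == mu then f else 0.
Proof.
move=> hf; apply/malgP => m; rewrite mhcomponentE.
have [mf|mf] := boolP (m \in msupp f).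
  by rewrite (hf _ mf); case: ifP; rewrite ?mcoeff0.
by rewrite (mcoeff_outdom mf); case: ifP; case: ifP;
   rewrite ?mcoeff0 ?(mcoeff_outdom mf).
Qed.

(** Multidegrees add up and addition of multidegrees is cancellative, so the
    component of multidegree [mu] of the product comes from the component of
    multidegree [mu - multideg m] of [f]; if this difference has a negative
    entry, no monomial of the product has multidegree [mu]. *)
Lemma mhcomponentUM mu c m f :
  (exists nu, mhcomponent mu (<< c *g m >> * f) =
              << c *g m >> * mhcomponent nu f)
  \/ mhcomponent mu (<< c *g m >> * f) = 0.
Proof.
have homUU d n :
    homog (mmul (multideg m) (multideg n)) (<< c *g m >> * << d *g n >>).
  by apply: homogM; apply: homogU.
have [[nu <-]|no] := pselect (exists nu, mmul (multideg m) nu = mu).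
- left; exists nu; elim/placed_poly_monom_ind: f => [|f g IHf IHg|d n].
  + have c0 : mhcomponent nu (0 : placed_poly K V) = 0.
      by rewrite (mhcomponent_homog _ nu) ?eqxx //; apply: homog0.
    rewrite c0 !mulr0.
    by rewrite (mhcomponent_homog _ mone) ?if_same //; apply: homog0.
  + rewrite (mulrDr << c *g m >> f g) (mhcomponentD nu f g) mulrDr.
    exact: (etrans (mhcomponentD _ _ _) (f_equal2 +%R IHf IHg)).
  + rewrite (mhcomponent_homog _ _ _ (homUU d n)).
    rewrite (mhcomponent_homog _ _ _ (homogU d n)) (inj_eq (mmulI _)).
    by case: ifP; rewrite ?mulr0.
- right; elim/placed_poly_monom_ind: f => [|f g IHf IHg|d n].
  + by rewrite mulr0 (mhcomponent_homog _ mone) ?if_same //; apply: homog0.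
  + rewrite (mulrDr << c *g m >> f g) -[RHS]addr0.
    exact: (etrans (mhcomponentD _ _ _) (f_equal2 +%R IHf IHg)).
  + rewrite (mhcomponent_homog _ _ _ (homUU d n)).
    by case: eqP => // e; case: no; exists (multideg n).
Qed.
End Homogeneity.

(** * Substitution, shifts and psi *)

Section Substitution.
Import GRing.Theory.
Local Open Scope ring_scope.
Context {K : fieldType} {V W : choiceType} (h : V -> place -> placed_poly K W).
Implicit Types f g : placed_poly K V.

Lemma substU c (m : {cmonom (V * place)%type}) :
  subst h << c *g m >> = c%:MP * cmfold *%R (fun p => h p.1 p.2) m.
Proof. exact: mmapU. Qed.

Lemma substD f g : subst h (f + g) = subst h f + subst h g.
Proof. exact: mmapD. Qed.

Lemma substC c : subst h c%:MP = c%:MP.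
Proof. by rewrite substU cmfold1 mulr1. Qed.

Lemma subst0 : subst h 0 = 0.
Proof. by have := substC 0; rewrite !malgC0E. Qed.

Lemma subst1 : subst h 1 = 1.
Proof. by have := substC 1; rewrite !mpolyC1E. Qed.

Lemma subst_var v j : subst h (var K v j) = h v j.
Proof. by rewrite substU cmfoldU mpolyC1E mul1r. Qed.

Lemma substM f g : subst h (f * g) = subst h f * subst h g.
Proof.
move: f; apply: placed_poly_monom_ind => [|f1 f2 IH1 IH2|c m].
- by rewrite mul0r subst0 mul0r.
- rewrite (mulrDl f1 f2 g) (substD f1 f2) mulrDl.
  exact: (etrans (substD _ _) (f_equal2 +%R IH1 IH2)).
move: g; apply: placed_poly_monom_ind => [|g1 g2 IH1 IH2|d n].
- by rewrite mulr0 subst0 mulr0.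
- rewrite (mulrDr _ g1 g2) (substD g1 g2) mulrDr.
  exact: (etrans (substD _ _) (f_equal2 +%R IH1 IH2)).
rewrite [X in subst h X](fgmulUU c d m n).
rewrite [LHS]substU [X in _ = X * _]substU [X in _ = _ * X]substU.
rewrite mpolyCM cmfoldM.
exact: mulrACA.
Qed.
End Substitution.

Section Morphisms.
Import GRing.Theory.
Local Open Scope ring_scope.
Context {K : fieldType}.

Section Shift.
Context {V : choiceType} (k : nat).
Implicit Types f g : placed_poly K V.

Lemma shift0 : shift k (0 : placed_poly K V) = 0.
Proof. exact: subst0. Qed.

Lemma shiftD f g : shift k (f + g) = shift k f + shift k g.
Proof. exact: substD. Qed.

Lemma shiftM f g : shift k (f * g) = shift k f * shift k g.
Proof. exact: substM. Qed.

Lemma shiftC c : shift k (c%:MP : placed_poly K V) = c%:MP.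
Proof. exact: substC. Qed.

Lemma shift_var v j :
  shift k (var K v j) = var K v (shift_place k j) :> placed_poly K V.
Proof. exact: subst_var. Qed.

Definition shift_deg (mu : {cmonom place}) : {cmonom place} :=
  cmfold mmul (fun j => ucm (shift_place k j)) mu.

(** Shifting replaces place j by place k + j in each variable, so the
    multidegree of the shifted monomial is determined by the original one. *)
Lemma homog_shift mu f : homog mu f -> homog (shift_deg mu) (shift k f).
Proof.
move=> hf; rewrite (monalgE f) big_seq.
apply: (big_ind (fun g => homog (shift_deg mu) (shift k g))).
- by rewrite shift0; apply: homog0.
- by move=> g1 g2 h1 h2; rewrite shiftD; exact: (homogD _ _ _ h1 h2).
move=> m /hf <-; move: (f@_m) => c.
move: m; apply: cmonom_ind => [|[v j] m IHm].
  by rewrite shiftC multideg1 /shift_deg cmfold1; exact: homogC.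
rewrite malgU_var shiftM multidegM multidegU /shift_deg cmfoldM cmfoldU.
apply: homogM IHm; rewrite shift_var; exact: homog_var.
Qed.
End Shift.

Section Psi.
Context {X : choiceType}.
Implicit Types f g : placed_poly K (option X).

Lemma psi0 : psi (0 : placed_poly K (option X)) = 0.
Proof. exact: subst0. Qed.

Lemma psiD f g : psi (f + g) = psi f + psi g.
Proof. exact: substD. Qed.

Lemma psiM f g : psi (f * g) = psi f * psi g.
Proof. exact: substM. Qed.

Lemma psiC c : psi (c%:MP : placed_poly K (option X)) = c%:MP.
Proof. exact: substC. Qed.

Lemma psi1 : psi (1 : placed_poly K (option X)) = 1.
Proof. exact: subst1. Qed.

Lemma psi_x x j : psi (var K (Some x) j) = var K x j :> placed_poly K X.
Proof. exact: subst_var. Qed.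

Lemma psi_t j : psi (var K None j) = 1 :> placed_poly K X.
Proof. exact: subst_var. Qed.

(** Both composites are algebra morphisms, so it suffices to compare them on
    variables; on t(j) both give 1, as a shift of t(j) is again some t(i). *)
Lemma psi_shift k f : psi (shift k f) = shift k (psi f).
Proof.
move: f; apply: placed_poly_ind => [c|f g IHf IHg|v j f IHf].
- by rewrite shiftC !psiC shiftC.
- rewrite shiftD (psiD f g) (shiftD _ (psi f)).
  exact: (etrans (psiD _ _) (f_equal2 +%R IHf IHg)).
rewrite shiftM [LHS]psiM [X in _ = shift k X]psiM [RHS]shiftM.
apply: f_equal2 IHf; rewrite [X in psi X]shift_var.
case: v => [x|].
  exact: (etrans (psi_x _ _)
    (esym (etrans (f_equal _ (psi_x x j)) (shift_var _ _ _)))).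
exact: (etrans (psi_t _) (esym (etrans (f_equal _ (psi_t j)) (subst1 _)))).
Qed.
End Psi.
End Morphisms.

(** * The correspondence between ideals *)

Section Correspondence.
Import GRing.Theory.
Local Open Scope ring_scope.
Context {K : fieldType} {X : choiceType}.
Local Notation P := (placed_poly K X).
Local Notation Pbar := (placed_poly K (option X)).
Implicit Types (I : set P) (J : set Pbar).

(** The padding factor: the product of the t(j), each raised to the power
    [mu j]. *)
Lemma psi_t_monomial mu : exists2 T : Pbar, homog mu T & psi T = 1.
Proof.
move: mu; apply: cmonom_ind => [|j mu [T hT psiT]].
  by exists 1; [exact: homogC | exact: psi1].
exists (var K None j * T); first exact: (homogM _ _ _ _ (homog_var _ _) hT).
by rewrite psiM psi_t psiT mul1r.
Qed.

(** In the induction, lifts of two summands of multidegrees [mu] and [nu] are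
    both brought to multidegree [mu + nu], each being multiplied by the
    t-monomial of the other's multidegree. *)
Lemma psi_homog_surj (f : P) :
  exists mu, exists2 F : Pbar, homog mu F & psi F = f.
Proof.
move: f; apply: placed_poly_ind =>
  [c|f g [mu [F hF <-]] [nu [G hG <-]]|x j f [mu [F hF <-]]].
- by exists mone, c%:MP; [exact: homogC | exact: psiC].
- have [Tmu hTmu psiTmu] := psi_t_monomial mu.
  have [Tnu hTnu psiTnu] := psi_t_monomial nu.
  exists (mmul mu nu), (F * Tnu + Tmu * G).
    exact: (homogD _ _ _ (homogM _ _ _ _ hF hTnu) (homogM _ _ _ _ hTmu hG)).
  rewrite psiD [X in X + _ = _]psiM [X in _ + X = _]psiM.
  by rewrite psiTmu psiTnu mulr1 mul1r.
- exists (mmul (ucm j) mu), (var K (Some x) j * F).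
    exact: (homogM _ _ _ _ (homog_var _ _) hF).
  by rewrite psiM psi_x.
Qed.

Lemma is_ideal_multihomogenization I : is_ideal (multihomogenization I).
Proof.
split=> [J [[]] //|f g If Ig J HJ|f g Ig J HJ]; case: (HJ) => -[_ JD JM] _.
- apply: JD; [exact: If | exact: Ig].
- by apply: JM; apply: Ig.
Qed.

Lemma multihomogenization_gen I mu f :
  homog mu f -> I (psi f) -> multihomogenization I f.
Proof. by move=> hf If J [_]; apply; split=> //; exists mu. Qed.

Lemma is_ideal_psi_preim I : is_ideal I -> is_ideal [set f : Pbar | I (psi f)].
Proof.
move=> [I0 ID IM]; split=> [|f g|f g] /=.
- by rewrite psi0.
- by rewrite psiD; apply: ID.
- by rewrite psiM; apply: IM.
Qed.

Lemma is_ideal_shift_preim k J : is_ideal J -> is_ideal [set f | J (shift k f)].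
Proof.
move=> [J0 JD JM]; split=> [|f g|f g] /=.
- by rewrite shift0.
- by rewrite shiftD; apply: JD.
- by rewrite shiftM; apply: JM.
Qed.

(** Stability under multiplication reduces by additivity to multiplication by
    a monomial, where [mhcomponentUM] applies. *)
Lemma is_ideal_mhcomponents J : is_ideal J ->
  is_ideal [set f | forall mu, J (mhcomponent mu f)].
Proof.
move=> [J0 JD JM]; split=> [mu|f g Jf Jg mu|f g Jg] /=.
- by rewrite (mhcomponent_homog _ mone) ?if_same //; apply: homog0.
- by rewrite mhcomponentD; apply: JD.
move: f; apply: placed_poly_monom_ind => [|f1 f2 IH1 IH2|c m] mu.
- by rewrite mul0r (mhcomponent_homog _ mone) ?if_same //; apply: homog0.
- rewrite (mulrDl f1 f2 g) [X in J X]mhcomponentD.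
  exact: (JD _ _ (IH1 mu) (IH2 mu)).
- by have [[nu ->]|->] := mhcomponentUM mu c m g => //; apply/JM/Jg.
Qed.

Lemma N_ideal_multihomogenization I :
  N_ideal I -> N_ideal (multihomogenization I).
Proof.
move=> [_ Ishift]; have idI := is_ideal_multihomogenization I.
split=> // k f If; apply: (If [set g | multihomogenization I (shift k g)]).
split; first exact: is_ideal_shift_preim.
move=> g [[mu hg] Ig]; apply: multihomogenization_gen (homog_shift k mu g hg) _.
by rewrite psi_shift; apply: Ishift.
Qed.

Lemma multigraded_multihomogenization I : multigraded (multihomogenization I).
Proof.
have idI := is_ideal_multihomogenization I.
move=> mu f If; move: mu; apply: (If [set f | forall mu, _]).
split; first exact: is_ideal_mhcomponents.
move=> g [[nu hg] Ig] mu /=; rewrite (mhcomponent_homog _ _ _ hg).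
case: ifP => _; first exact: multihomogenization_gen hg Ig.
by case: idI.
Qed.

Lemma psi_multihomogenization I :
  is_ideal I -> @psi K X @` multihomogenization I = I.
Proof.
move=> idI; apply/seteqP; split=> [_ [F IF <-]|f If].
  apply: (IF [set F | I (psi F)]); split; first exact: is_ideal_psi_preim.
  by move=> G [].
have [mu [F hF psiF]] := psi_homog_surj f.
by exists F => //; apply: multihomogenization_gen hF _; rewrite psiF.
Qed.

(** Multiplication by an arbitrary element of P lifts because psi is
    surjective. *)
Lemma N_ideal_psi_image J : N_ideal J -> N_ideal (@psi K X @` J).
Proof.
move=> [[J0 JD JM] Jshift]; split; first split.
- by exists 0 => //; rewrite psi0.
- move=> _ _ [F JF <-] [G JG <-]; exists (F + G); first exact: JD.
  by rewrite psiD.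
- move=> f _ [G JG <-]; have [_ [F _ <-]] := psi_homog_surj f.
  by exists (F * G); [apply: JM | rewrite psiM].
- move=> k _ [F JF <-]; exists (shift k F); first exact: Jshift.
  exact: psi_shift.
Qed.
End Correspondence.

Theorem mainTheorem5 (K : fieldType) (X : countType) :
  set_bij
    [set I : set (placed_poly K X) | N_ideal I]
    [set J : set (placed_poly K (option X)) |
      [/\ N_ideal J, multigraded J & saturated J]]
    (@multihomogenization K X).
Proof.
split.
- move=> I /= NI; split.
  + exact: N_ideal_multihomogenization.
  + exact: multigraded_multihomogenization.
  + by rewrite /saturated /Sat psi_multihomogenization //; case: NI.
- move=> I1 I2 /set_mem[id1 _] /set_mem[id2 _] eqI.
  by rewrite -(psi_multihomogenization I1 id1) eqI psi_multihomogenization.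
- move=> J /= [NJ _ satJ]; exists (@psi K X @` J) => //.
  exact: N_ideal_psi_image.
Qed.
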